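(* Let $D$ be a layered DAG and $u \le v$. Then $$MC_{k,d(u,v)}^{(u,v)}(D) \cong \tilde C_{k-2}(\Delta((u,v))),$$ where $\tilde C_\bullet$ indicates the augmented simplicial chain complex of $\Delta((u,v))$, the order complex of the open interval $(u,v)$. Furthermore, $MC_{k,L}^{(u,v)}(D) = 0$ for $L \ne d(u,v)$.
   Context: All digraphs and posets are finite. An st-DAG is a directed acyclic graph (DAG) with a unique source (vertex of indegree zero) and a unique target (vertex of outdegree zero). For vertices $u,v$ of a DAG $D$, $u \le v$ means there is a directed path (possibly of length zero) from $u$ to $v$; this is a partial order on the vertex set $V(D)$. Let $d(u,v) \in [0,\infty]$ be the length (number of arcs) of a shortest directed path from $u$ to $v$, with $d(u,u)=0$ and $d(u,v)=\infty$ if there is no directed path. A finite st-DAG is layered if for $u \le v$, every directed path from $u$ to $v$ has length $d(u,v)$; ''layered DAG'' means such an st-DAG. The open interval is $(u,v)=\{w : u<w<v\}$, a subposet. The order complex $\Delta(Q)$ of a poset $Q$ is the abstract simplicial complex whose $(k-1)$-simplices are the $k$-element chains of $Q$. Let $R$ be the coefficient ring; $\tilde C_\bullet$ denotes the augmented simplicial chain complex over $R$, with $\tilde C_{-1} \cong R$. The isomorphism is understood as one of chain complexes with degree shift by $2$, the differentials corresponding up to sign. A $k$-simplex is an ordered tuple $x=(x_0,\dots,x_k) \in V(D)^{k+1}$ whose adjacent entries are distinct; its length is $\lambda(x) = \sum_{j=1}^k d(x_{j-1},x_j)$. For real $L$, $MC_{k,L}(D)$ is the free $R$-module on the $k$-simplices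 $x$ with $\lambda(x)=L$. The differential $\partial_k : MC_{k,L}(D) \to MC_{k-1,L}(D)$ is $\partial_k = \sum_{j=1}^{k-1} (-1)^j \partial^{(j)}$, where $\partial^{(j)}(x)$ is the tuple obtained from $x$ by deleting the entry $x_j$ if $d(x_{j-1},x_{j+1}) = d(x_{j-1},x_j) + d(x_j,x_{j+1})$, and $\partial^{(j)}(x)=0$ otherwise. $MC_{\bullet,L}^{(u,v)}(D)$ is the subcomplex of $MC_{\bullet,L}(D)$ generated by simplices with $x_0=u$ and $x_k=v$.
   Formalization: The isomorphism is stated for u ≠ v only, since for u = v it fails (MC_0 = R but C̃_{-2}(Δ(∅)) = 0); for u = v it is replaced by: MC_{0,0}^{(u,u)} ≅ R and MC_{k,0}^{(u,u)} = 0 for k > 0. *)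

(* Defs.v *)
From HB Require Import structures.
From mathcomp Require Import all_boot all_order all_algebra.
From mathcomp Require Import constructive_ereal reals.

Set Implicit Arguments.
Unset Strict Implicit.
Unset Printing Implicit Defensive.

Import Order.TTheory GRing.Theory Num.Theory.

Local Open Scope ring_scope.

Section Digraph.
Variables (V : finType) (e : rel V).

Definition acyclic : Prop := forall c : seq V, cycle e c -> c = [::].

Definition indegree (v : V) : nat := #|[set w | e w v]|.
Definition outdegree (v : V) : nat := #|[set w | e v w]|.

Definition st_dag : Prop :=
  [/\ acyclic, exists! s : V, indegree s = 0%N
    & exists! t : V, outdegree t = 0%N].

(* [dag_le u v] is [u <= v]; it is a partial order when [e] is acyclic. *)
Definition dag_le : rel V := connect e.
Definition dag_lt : rel V := [rel u v | (u != v) && dag_le u v].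

Definition open_interval (u v : V) : {set V} :=
  [set w | dag_lt u w && dag_lt w v].

Definition has_path (u v : V) (n : nat) : bool :=
  [exists p : n.-tuple V, path e u p && (last u p == v)].

Lemma dag_le_has_path u v : dag_le u v -> exists n, has_path u v n.
Proof.
case/connectP=> p ep ->; exists (size p).
by apply/existsP; exists (in_tuple p); rewrite ep /=.
Qed.

(* The least length of a directed path, [+oo] if there is none. *)
Definition dist (K : realType) (u v : V) : \bar K :=
  if @idP (dag_le u v) is ReflectT uv
  then ((ex_minn (dag_le_has_path uv))%:R)%:E else +oo%E.

Definition layered_dag (K : realType) : Prop :=
  st_dag /\
  forall (u v : V) (p : seq V), path e u p -> last u p = v ->
    ((size p)%:R)%:E = dist K u v.

End Digraph.

Section MagnitudeComplex.
Variables (K : realType) (R : pzRingType) (V : finType) (e : rel V).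

Local Notation d := (dist e K).

Definition entry k (x : k.+1.-tuple V) (j : nat) : V := nth (thead x) x j.

Definition len k (x : k.+1.-tuple V) : \bar K :=
  (\sum_(1 <= j < k.+1) d (entry x j.-1) (entry x j))%E.

Definition mag_simplex (k : nat) (L : K) : finType :=
  {x : k.+1.-tuple V | sorted [rel a b | a != b] x && (len x == L%:E)}.

Definition MC (k : nat) (L : K) : lmodType R := {ffun mag_simplex k L -> R^o}.

(* The generator on [s]; it is [0] if [s] is not a [k]-simplex of length [L]. *)
Definition mag_gen k L (s : seq V) : MC k L :=
  [ffun y => ((tval (val y) == s)%:R : R^o)].

(* The tuple with [x_j] deleted is again a simplex of the same length whenever
   the test succeeds, so that the default value of [mag_gen] is never used. *)
Definition mag_face k L (j : nat) (x : mag_simplex k.+1 L) : MC k L :=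
  let a := entry (val x) in
  if d (a j.-1) (a j.+1) == (d (a j.-1) (a j) + d (a j) (a j.+1))%E
  then mag_gen k L (take j (val x) ++ drop j.+1 (val x)) else 0.

(* The differential from degree [k.+1] to degree [k]; the one from degree 0 is
   zero. *)
Definition mag_bd k L (f : MC k.+1 L) : MC k L :=
  \sum_x f x *: \sum_(1 <= j < k.+1) (-1) ^+ j *: mag_face j x.

(* The submodule spanned by the simplices from [u] to [v]. *)
Definition from_to k L (u v : V) : {pred MC k L} := fun f : MC k L =>
  [forall x, (f x != 0) ==>
     ((entry (val x) 0 == u) && (entry (val x) k == v))].
Arguments from_to : clear implicits.

Fact from_to_submod_closed k L u v : submod_closed (from_to k L u v).
Proof.
split=> [|a f g /forallP Hf /forallP Hg]; apply/forallP=> x; rewrite !ffunE.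
 by apply/implyP=> /eqP[].
apply/implyP=> nz; case: (eqVneq (f x) 0) => [f0|/(implyP (Hf x))//].
by apply: (implyP (Hg x)); apply: contraNneq nz => ->; rewrite f0 scaler0 addr0.
Qed.
HB.instance Definition _ k L u v :=
  GRing.isSubmodClosed.Build R (MC k L) (from_to k L u v)
    (from_to_submod_closed k L u v).

Record MC_uv (u v : V) (k : nat) (L : K) :=
  InMC_uv { mc_val :> MC k L; _ : mc_val \in from_to k L u v }.

HB.instance Definition _ u v k L := [isSub for @mc_val u v k L].
HB.instance Definition _ u v k L := [Choice of MC_uv u v k L by <:].
HB.instance Definition _ u v k L :=
  [SubChoice_isSubLmodule of MC_uv u v k L by <:].

Lemma mag_face_from_to k L u v j (x : mag_simplex k.+1 L) :
    (0 < j <= k)%N -> entry (val x) 0 = u -> entry (val x) k.+1 = v ->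
  mag_face j x \in from_to k L u v.
Proof.
move=> /andP[j_gt0 lejk] x0 xk; rewrite /mag_face; case: ifP => _; last first.
  by have [] := from_to_submod_closed k L u v.
apply/forallP=> y; rewrite ffunE.
case: (tval (val y) =P _) => [yE|_]; last by rewrite eqxx.
apply/implyP=> _; have sx := size_tuple (val x).
have Ej : entry (val y) =1 fun i => nth (thead (val y))
    (take j (val x) ++ drop j.+1 (val x)) i.
  by move=> i; rewrite /entry yE.
have szt : size (take j (val x)) = j.
  by rewrite size_takel // sx (leq_trans lejk) // -addn2 leq_addr.
rewrite !Ej !nth_cat szt j_gt0 ltnNge lejk /= nth_take // nth_drop addSn subnKC //.
by rewrite -x0 -xk; apply/andP; split; apply/eqP/set_nth_default; rewrite sx.
Qed.

Lemma mag_bd_from_to k L u v (f : MC k.+1 L) :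
  f \in from_to k.+1 L u v -> mag_bd f \in from_to k L u v.
Proof.
move=> /forallP Hf; apply: rpred_sum => x _.
case: (eqVneq (f x) 0) => [->|nz]; first by rewrite scale0r rpred0.
have /andP[/eqP x0 /eqP xk] := implyP (Hf x) nz.
apply: rpredZ; rewrite big_nat; apply: rpred_sum => j jk; apply: rpredZ.
exact: mag_face_from_to.
Qed.

Definition mag_bd_uv u v k L (f : MC_uv u v k.+1 L) : MC_uv u v k L :=
  InMC_uv (mag_bd_from_to (valP f)).

End MagnitudeComplex.

Definition order_complex (V : finType) (le : rel V) (Q : {set V}) :
    {set {set V}} :=
  [set c : {set V} | (c \subset Q) &&
     [forall x in c, forall y in c, le x y || le y x]].

Section SimplicialComplex.
(* [S] is an abstract simplicial complex, with the empty simplex included;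
   [lt] restricts to a strict total order on every simplex of [S] and gives the
   orientations. *)
Variables (R : pzRingType) (V : finType) (lt : rel V) (S : {set {set V}}).

Definition dim (s : {set V}) : int := #|s|%:Z - 1.

Definition simplex (n : int) : finType :=
  {s : {set V} | (s \in S) && (dim s == n)}.

(* Augmented simplicial chains: the empty simplex spans degree [-1]. *)
Definition aug_chain (n : int) : lmodType R := {ffun simplex n -> R^o}.

Definition simp_gen n (s : {set V}) : aug_chain n :=
  [ffun t => ((val t == s)%:R : R^o)].

(* For [m = n + 1] this is the simplicial boundary from degree [m] to degree
   [n]: the exponent is the position of [a] in the simplex listed increasingly,
   counted from 0.  For other [m] it is [0].  Leaving [m] and [n] independent
   avoids transports along equations between degrees. *)
Definition simp_bd m n (f : aug_chain m) : aug_chain n :=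
  \sum_s f s *: \sum_(a in val s)
    (-1) ^+ #|[set b in val s | lt b a]| *: simp_gen n (val s :\ a).

End SimplicialComplex.

(* Main.v *)
Require Import Defs.
From HB Require Import structures.
From mathcomp Require Import all_boot all_order all_algebra.
From mathcomp Require Import constructive_ereal reals.
From mathcomp Require Import zify.

Set Implicit Arguments.
Unset Strict Implicit.
Unset Printing Implicit Defensive.

Import Order.TTheory GRing.Theory Num.Theory.
Local Open Scope ring_scope.

(** In a layered digraph all directed paths between two given vertices have the
    same length, so d is additive on a <= b <= c ([dist_additive]).  A simplex
    of finite length has consecutive entries joined by paths; since consecutive
    entries are distinct and the digraph is acyclic, it is a strictly increasing
    sequence, and its length telescopes to the distance between its ends
    ([uv_simplex]).  This already shows that simplices from u to v exist only in
    length d(u,v), and, when u = v, only in degree 0.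

    Let u <> v.  A simplex of degree k from u to v is then u, p, v with p an
    increasing list of k - 1 elements of the open interval ([simplex_fill],
    [fill_simplex]), and such lists are the same thing as chains with k - 1
    elements, that is, simplices of dimension k - 2 of the order complex
    ([interval_chain_simplex], [simplex_interval_chain]).  Both complexes are
    free, so this bijection of bases extends to an isomorphism in each degree,
    with inverse induced by sorting a chain ([of_intervalK], [to_intervalK]).

    For the differentials, additivity of d means that every inner entry can
    be deleted, so both boundaries are the alternating sum over all elements of
    p of the chain with this element removed.  An element at position i in p, counted from 0,
    is at position i + 1 in u, p, v.  Hence the signs are opposite in every
    degree ([to_interval_bd]). *)

(** * Linear maps out of a free module *)

Section LinearExtension.
Variables (R : pzRingType) (X : finType).
Implicit Types M N : lmodType R.

Definition lin_ext M (b : X -> M) (f : {ffun X -> R^o}) : M :=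
  \sum_x (f x : R) *: b x.

Lemma lin_ext_is_linear M (b : X -> M) : linear (lin_ext b).
Proof.
move=> a f g; rewrite /lin_ext scaler_sumr -big_split /=.
by apply: eq_bigr => x _; rewrite !ffunE scalerDl scalerA.
Qed.

HB.instance Definition _ M (b : X -> M) :=
  GRing.isLinear.Build R {ffun X -> R^o} M *:%R (lin_ext b)
    (lin_ext_is_linear b).

Lemma lin_ext_delta M (b : X -> M) x (f : {ffun X -> R^o}) :
  (forall y, f y = (y == x)%:R) -> lin_ext b f = b x.
Proof.
move=> fE; rewrite /lin_ext (bigD1 x) //= fE eqxx scale1r big1 ?addr0 // => y.
by rewrite fE => /negPf ->; rewrite scale0r.
Qed.

Lemma eq_lin_ext M (b b' : X -> M) (f : {ffun X -> R^o}) :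
  (forall x, f x != 0 -> b x = b' x) -> lin_ext b f = lin_ext b' f.
Proof.
move=> eqb; apply: eq_bigr => x _.
by have [->|/eqb ->//] := eqVneq (f x) 0; rewrite !scale0r.
Qed.

Lemma linear_lin_ext M N (h : {linear M -> N}) (b : X -> M)
    (f : {ffun X -> R^o}) :
  h (lin_ext b f) = lin_ext (h \o b) f.
Proof. by rewrite linear_sum; apply: eq_bigr => x _; rewrite linearZ. Qed.

Lemma lin_ext_id (b : X -> {ffun X -> R^o}) (f : {ffun X -> R^o}) :
  (forall x, f x != 0 -> forall y, b x y = (y == x)%:R) -> lin_ext b f = f.
Proof.
move=> bE; apply/ffunP=> y; rewrite sum_ffunE.
rewrite (eq_bigr (fun x => f x * (y == x)%:R)) => [|x _]; last first.
  have [fx0|/bE bxE] := eqVneq (f x) 0; last by rewrite ffunE bxE.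
  by rewrite ffunE fx0 scale0r mul0r.
rewrite (bigD1 y) //= eqxx mulr1 big1 ?addr0 // => x.
by rewrite eq_sym => /negPf ->; rewrite mulr0.
Qed.

End LinearExtension.

(** * Strictly sorted sequences and chains *)

Section StrictlySorted.
Variables (V : eqType) (lt : rel V).
Hypotheses (lt_irr : irreflexive lt) (lt_trans : transitive lt).

(** The sign of a face in the simplicial boundary is given by the number of
    smaller elements, and in the magnitude complex by a position. *)
Lemma count_lt_sorted (x0 : V) p i : sorted lt p -> (i < size p)%N ->
  count (lt^~ (nth x0 p i)) p = i.
Proof.
elim: p i => [//|a p IHp] [|i] /= ltp ilt.
  have /allP lt_a := order_path_min lt_trans ltp.
  rewrite lt_irr add0n; apply/eqP; rewrite -leqn0 leqNgt -has_count.
  apply/hasPn => b /lt_a ltab; apply/negP => /(lt_trans ltab).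
  by rewrite lt_irr.
have /allP -> /= := order_path_min lt_trans ltp; last exact: mem_nth.
by rewrite IHp // (path_sorted ltp).
Qed.

End StrictlySorted.

Section Order.
Variables (V : finType) (e : rel V).
Hypothesis e_acyclic : acyclic e.

Lemma dag_le_trans : transitive (dag_le e).
Proof. exact: connect_trans. Qed.

(** Paths both ways between distinct vertices would close up to a cycle. *)
Lemma dag_le_anti : antisymmetric (dag_le e).
Proof.
move=> a b /andP[/connectP[[//|c p] ep ->] /connectP[q eq aE]].
have: path e a ((c :: p) ++ q) by rewrite cat_path ep.
rewrite [_ ++ q]lastI last_cat -aE => cyc.
by have := e_acyclic (c := a :: _) cyc.
Qed.

Lemma dag_lt_irr : irreflexive (dag_lt e).
Proof. by move=> a; rewrite /dag_lt /= eqxx. Qed.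

Lemma dag_lt_trans : transitive (dag_lt e).
Proof.
rewrite /dag_lt => b a c /= /andP[ab leab] /andP[bc lebc].
rewrite (dag_le_trans leab lebc) andbT; apply: contraNneq ab => ac.
by apply/eqP/dag_le_anti; rewrite leab ac lebc.
Qed.

Lemma sorted_dag_lt (s : seq V) :
  sorted (dag_lt e) s = sorted [rel a b | a != b] s && sorted (dag_le e) s.
Proof.
case: s => [//|a s] /=; elim: s a => [//|b s IHs] a /=.
by rewrite IHs andbACA.
Qed.

End Order.

(** * Lengths in a layered digraph *)

Section Layered.
Variables (K : realType) (V : finType) (e : rel V).

Lemma dist_fin_num u v : (dist e K u v \is a fin_num) = dag_le e u v.
Proof.
rewrite /dist.
(* The index of the reflection view has to vary on its own, because the proof it
   carries is also an argument of the dependent minimum. *)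
have dist_view b (r : reflect (dag_le e u v) b) :
    ((if r is ReflectT uv then (ex_minn (dag_le_has_path uv))%:R%:E
      else +oo%E : \bar K) \is a fin_num) = b by case: r.
exact: dist_view.
Qed.

Hypothesis D_layered : layered_dag e K.

Lemma dist_additive a b c : dag_le e a b -> dag_le e b c ->
  dist e K a c = (dist e K a b + dist e K b c)%E.
Proof.
have [_ layered] := D_layered.
move=> /connectP[p ep ->{b}] /connectP[q eq ->{c}].
rewrite -(layered _ _ _ ep erefl) -(layered _ _ _ eq erefl).
rewrite -(layered a _ (p ++ q)) ?cat_path ?ep ?last_cat //.
by rewrite -EFinD -natrD size_cat.
Qed.

Lemma dist_refl a : dist e K a a = 0%E.
Proof. by have [_ layered] := D_layered; rewrite -(layered a a [::]). Qed.

(** A single missing path makes the whole sum infinite. *)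
Lemma len_fin_num_sorted k (x : k.+1.-tuple V) :
  len K e x \is a fin_num -> sorted (dag_le e) x.
Proof.
rewrite /len big_add1 => /sum_fin_numP fin.
apply/(sortedP (thead x)) => i; rewrite size_tuple ltnS => ik.
by rewrite -dist_fin_num fin // mem_index_iota.
Qed.

(** The sum telescopes because d is additive. *)
Lemma len_sorted k (x : k.+1.-tuple V) : sorted (dag_le e) x ->
  len K e x = dist e K (entry x 0) (entry x k).
Proof.
move=> /(sortedP (thead x)) lex; rewrite /len big_add1 /=.
have: (k < size x)%N by rewrite size_tuple.
suff H m : (m < size x)%N -> dag_le e (entry x 0) (entry x m) /\
    (\sum_(0 <= i < m) dist e K (entry x i) (entry x i.+1))%E
      = dist e K (entry x 0) (entry x m) by move=> /H [].
elim: m => [|m IHm] mx.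
  by rewrite big_geq // dist_refl; split => //; apply: connect0.
have [le0m sumE] := IHm (ltnW mx); split; first exact: connect_trans (lex m mx).
by rewrite big_nat_recr //= sumE -dist_additive //; apply: lex.
Qed.

End Layered.

(** * Simplices from u to v and chains of the open interval *)

(** [entry] takes its default value from the tuple itself, which blocks
    rewriting the tuple; a fixed default does not. *)
Lemma entry_nth (V : finType) (a : V) k (x : k.+1.-tuple V) j :
  (j <= k)%N -> entry x j = nth a x j.
Proof. by move=> jk; apply: set_nth_default; rewrite size_tuple. Qed.

Lemma set_rem (V : finType) (a : V) p :
  uniq p -> [set w in rem a p] = [set w in p] :\ a.
Proof. by move=> up; apply/setP=> w; rewrite !inE mem_rem_uniq // inE. Qed.

Section Correspondence.
Variables (K : realType) (V : finType) (e : rel V) (u v : V).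
Hypothesis D_layered : layered_dag e K.
Hypothesis uv : dag_le e u v.

Local Notation I := (open_interval e u v).
Local Notation Delta := (order_complex (dag_le e) I).
Local Notation lt := (dag_lt e).
Local Notation Luv := (fine (dist e K u v) : K).

Let e_acyclic : acyclic e. Proof. by case: D_layered => -[]. Qed.
Let lt_irr := @dag_lt_irr V e.
Let lt_trans := dag_lt_trans e_acyclic.

Definition interval_chain (p : seq V) : bool := all (mem I) p && sorted lt p.

Definition fill (p : seq V) : seq V := u :: rcons p v.

Definition interior (s : seq V) : {set V} := [set w in s] :&: I.

(** A finite length forces each entry to reach the next one; the length then
    telescopes, so that it is determined by the ends. *)
Lemma uv_simplex k (L : K) (x : mag_simplex e k L) :
    entry (val x) 0 = u -> entry (val x) k = v ->
  sorted lt (val x) /\ dist e K u v = L%:E.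
Proof.
case: x => x /= /andP[neq_x /eqP lenx] <- <-.
have le_x : sorted (dag_le e) x.
  by apply: (@len_fin_num_sorted K); rewrite lenx.
by rewrite sorted_dag_lt neq_x -len_sorted.
Qed.

Lemma dist_fine : dist e K u v = Luv%:E.
Proof. by rewrite fineK // dist_fin_num. Qed.

Lemma interval_chain_uniq p : interval_chain p -> uniq p.
Proof. by case/andP=> _; apply: sorted_uniq. Qed.

(** Hence sorting recovers an increasing list from its underlying set, which
    makes the two descriptions of a chain inverse to each other. *)
Lemma eq_interval_chain p q : interval_chain p -> interval_chain q ->
  [set w in p] = [set w in q] -> p = q.
Proof.
move=> cp cq pq.
apply: (irr_sorted_eq lt_trans lt_irr) => [||w].
- by case/andP: cp.
- by case/andP: cq.
- by have := congr1 (fun A : {set V} => w \in A) pq; rewrite !inE.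
Qed.

Lemma interval_chain_simplex k p : interval_chain p -> (size p).+1 = k ->
  exists t : simplex Delta (k%:Z - 2), val t = [set w in p].
Proof.
move=> cp kE; have /andP[/allP pI lt_p] := cp.
suff tP : ([set w in p] \in Delta) && (Defs.dim [set w in p] == k%:Z - 2).
  by exists (Sub [set w in p] tP); rewrite SubK.
apply/andP; split; last first.
  by rewrite /Defs.dim cardsE (card_uniqP _) ?interval_chain_uniq // -kE; lia.
rewrite inE; apply/andP; split.
  by apply/subsetP => w; rewrite inE => /pI.
apply/forall_inP => a; rewrite inE => ap.
apply/forall_inP => b; rewrite inE => bp.
have le_p : sorted (dag_le e) p by move: lt_p; rewrite sorted_dag_lt => /andP[].
have le_index := sorted_leq_index (@dag_le_trans _ e) (@connect0 _ e) le_p.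
by case/orP: (leq_total (index a p) (index b p)) => /le_index -> //; rewrite orbT.
Qed.

Lemma simplex_interval_chain k (t : simplex Delta (k%:Z - 2)) :
  let p := sort (dag_le e) (enum (val t)) in
  [/\ interval_chain p, (size p).+1 = k & val t = [set w in p]].
Proof.
case: t => t /= /andP[]; rewrite inE => /andP[/subsetP tI /forall_inP le_t] dimt.
have mem_p w : (w \in sort (dag_le e) (enum t)) = (w \in t).
  by rewrite mem_sort mem_enum.
split.
- apply/andP; split; first by apply/allP => w; rewrite mem_p => /tI.
  rewrite sorted_dag_lt; apply/andP; split.
    have: uniq (sort (dag_le e) (enum t)) by rewrite sort_uniq enum_uniq.
    by rewrite uniq_pairwise => /pairwise_sorted.
  apply: (@sort_sorted_in _ (mem t)) => [a b at_ bt|].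
    exact: (forall_inP (le_t a at_)).
  by apply/allP => w; rewrite mem_enum.
- by move: dimt; rewrite size_sort -cardE /Defs.dim; lia.
- by apply/setP => w; rewrite inE mem_p.
Qed.

Hypothesis u_neq_v : u != v.

(** By transitivity, an increasing sequence from u to v has all its inner
    entries strictly between u and v. *)
Lemma path_fill p : path lt u (rcons p v) = interval_chain p.
Proof.
have -> : path lt u (rcons p v) = sorted lt (u :: rcons p v) by [].
rewrite sorted_pairwise //= pairwise_rcons all_rcons -sorted_pairwise //.
have -> : lt u v by rewrite /dag_lt /= u_neq_v.
rewrite /interval_chain andbA -all_predI; congr (_ && _).
by apply: eq_all => w; rewrite /= inE.
Qed.

Lemma interior_fill p : interval_chain p -> interior (fill p) = [set w in p].
Proof.
case/andP=> /allP pI _; apply/setP=> w.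
rewrite /interior !inE mem_rcons inE.
have [wp|_] := boolP (w \in p).
  by have := pI w wp; rewrite /= inE => ->; rewrite !orbT.
by rewrite orbF; apply/negP => /andP[/orP[]/eqP->]; rewrite lt_irr ?andbF.
Qed.

Lemma simplex_fill k (L : K) (x : mag_simplex e k L) :
    entry (val x) 0 = u -> entry (val x) k = v ->
  exists p, [/\ interval_chain p, (size p).+1 = k & val x = fill p :> seq V].
Proof.
move=> x0 xk; have [lt_x _] := uv_simplex x0 xk.
move: (size_tuple (val x)) lt_x x0 xk; rewrite !(entry_nth u) //.
case: (tval (val x)) => [//|a s] /= [<-] lt_s a_u.
case/lastP: s lt_s => [_ /=|p b].
  by rewrite a_u => vE; move: u_neq_v; rewrite vE eqxx.
rewrite size_rcons /= nth_rcons ltnn eqxx a_u => lt_s b_v; exists p.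
by rewrite /fill -path_fill -b_v.
Qed.

Lemma fill_simplex k p : interval_chain p -> (size p).+1 = k ->
  exists x : @mag_simplex K V e k Luv, val x = fill p :> seq V.
Proof.
move=> cp kE; have szp : size (fill p) == k.+1 by rewrite /= size_rcons kE.
have lt_p : sorted lt (fill p) by rewrite /= path_fill.
suff xP : sorted [rel a b | a != b] (Tuple szp) &&
          (len K e (Tuple szp) == Luv%:E).
  by exists (Sub (Tuple szp) xP); rewrite SubK.
have := lt_p; rewrite sorted_dag_lt => /andP[-> le_p] /=.
rewrite len_sorted // -dist_fine !(entry_nth u) //= -kE /= nth_rcons ltnn.
by rewrite !eqxx.
Qed.

(** * The isomorphism of chain complexes *)

Variable R : pzRingType.

Lemma from_to_ends k L (f : @MC K R V e k L) x :
  f \in from_to u v -> f x != 0 ->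
  entry (val x) 0 = u /\ entry (val x) k = v.
Proof. by move=> /forallP/(_ x)/implyP fP /fP /andP[/eqP ? /eqP ?]. Qed.

Lemma fill_from_to k L p : interval_chain p -> (size p).+1 = k ->
  @mag_gen K R V e k L (fill p) \in from_to u v.
Proof.
move=> cp kE; apply/forallP=> y; rewrite ffunE.
case: (tval (val y) =P _) => [yE|_]; last by rewrite eqxx.
by rewrite !(entry_nth u) // yE -kE /= nth_rcons ltnn !eqxx implybT.
Qed.

(** The value on a simplex that does not run from u to v is immaterial: such a
    simplex has coefficient zero in every chain of the subcomplex. *)
Definition to_interval k n (L : K) : MC R e k L -> aug_chain R Delta n :=
  lin_ext (fun x : mag_simplex e k L => simp_gen R Delta n (interior (val x))).

Definition of_interval k n : aug_chain R Delta n -> @MC K R V e k Luv :=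
  lin_ext (fun t : simplex Delta n =>
             mag_gen R e k Luv (fill (sort (dag_le e) (enum (val t))))).

HB.instance Definition _ k n L := GRing.Linear.on (@to_interval k n L).
HB.instance Definition _ k n := GRing.Linear.on (@of_interval k n).

(** A generator indexed by an arbitrary sequence is a basis vector only if that
    sequence is a simplex, which is where the assumption on [p] enters. *)
Lemma to_interval_fill k n p : interval_chain p -> (size p).+1 = k ->
  to_interval n (mag_gen R e k Luv (fill p)) = simp_gen R Delta n [set w in p].
Proof.
move=> cp kE; have [x xE] := fill_simplex cp kE.
rewrite -interior_fill // -xE; apply: lin_ext_delta => y.
by rewrite ffunE.
Qed.

Lemma of_intervalK k :
  cancel (@of_interval k (k%:Z - 2)) (@to_interval k (k%:Z - 2) Luv).
Proof.
move=> g; rewrite /of_interval linear_lin_ext; apply: lin_ext_id => t _ t' /=.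
have [cp kE tE] := simplex_interval_chain t.
by rewrite to_interval_fill // -tE ffunE.
Qed.

Lemma to_intervalK k (f : MC R e k Luv) : f \in from_to u v ->
  of_interval k (to_interval (k%:Z - 2) f) = f.
Proof.
move=> f_uv; rewrite /to_interval linear_lin_ext; apply: lin_ext_id => x fx0 y.
have [x0 xk] := from_to_ends f_uv fx0.
have [p [cp kE xE]] := simplex_fill x0 xk.
have [t tE] := interval_chain_simplex cp kE.
have [ct _ tE'] := simplex_interval_chain t.
rewrite /= xE interior_fill // -tE /of_interval.
rewrite (lin_ext_delta _ (x := t)) => [|t']; last by rewrite ffunE.
by rewrite ffunE (eq_interval_chain ct cp) -?xE // -tE'.
Qed.

Lemma of_interval_from_to k (g : aug_chain R Delta (k%:Z - 2)) :
  of_interval k g \in from_to u v.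
Proof.
apply: rpred_sum => t _; apply: rpredZ.
by have [cp kE _] := simplex_interval_chain t; apply: fill_from_to.
Qed.

(** The test in the definition of a face always succeeds, by additivity of d on
    the increasing entries of the simplex. *)
Lemma mag_face_fill k (x : @mag_simplex K V e k.+1 Luv) p i :
    val x = fill p :> seq V -> interval_chain p -> (i < size p)%N ->
  mag_face R i.+1 x = mag_gen R e k Luv (fill (rem (nth u p i) p)).
Proof.
move=> xE cp ip; have up := interval_chain_uniq cp.
have le_x : sorted (dag_le e) (fill p).
  have := cp; rewrite -path_fill -[path _ _ _]/(sorted lt (fill p)).
  by rewrite sorted_dag_lt => /andP[].
have pk : size p = k by have := size_tuple (val x); rewrite xE /= size_rcons; lia.
have le_entry j : (j <= size p)%N ->
    dag_le e (entry (val x) j) (entry (val x) j.+1).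
  move=> jp; rewrite !(entry_nth u) // ?xE; [|lia..].
  by apply: (sortedP _ le_x); rewrite /= size_rcons !ltnS.
rewrite /mag_face /= (dist_additive D_layered (le_entry i _) (le_entry i.+1 _)) //;
  last exact: ltnW.
rewrite eqxx xE remE index_uniq // /fill /=; congr (mag_gen _ _ _ _ (u :: _)).
rewrite drop_rcons // -!cats1 takel_cat ?(ltnW ip) //.
by rewrite catA.
Qed.

Lemma interval_chain_rem a p : interval_chain p -> interval_chain (rem a p).
Proof.
case/andP=> /allP pI lt_p; apply/andP; split.
  by apply/allP => w /mem_rem /pI.
exact: subseq_sorted (rem_subseq a p) lt_p.
Qed.

Lemma card_below p i : interval_chain p -> (i < size p)%N ->
  #|[set b in [set w in p] | lt b (nth u p i)]| = i.
Proof.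
move=> cp ip; have /andP[_ lt_p] := cp.
rewrite -[RHS](count_lt_sorted lt_irr lt_trans u lt_p ip) -size_filter.
rewrite -(card_uniqP _) ?filter_uniq ?interval_chain_uniq //.
by apply: eq_card => w; rewrite !inE mem_filter andbC.
Qed.

(** It suffices to compare the two sides on a basis element u, p, v; there both
    are sums over the elements of p, the index shift by one making the sign. *)
Lemma to_interval_bd k (f : MC R e k.+1 Luv) : f \in from_to u v ->
  to_interval (k%:Z - 2) (mag_bd f) =
    - simp_bd lt (k%:Z - 2) (to_interval (k.+1%:Z - 2) f).
Proof.
move=> f_uv.
(* Both sides become linear extensions of maps defined on the simplices of the
   magnitude complex. *)
pose bd_gen (s : {set V}) : aug_chain R Delta (k%:Z - 2) :=
  \sum_(a in s) (-1) ^+ #|[set b in s | lt b a]| *: simp_gen R Delta _ (s :\ a).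
have magE := linear_lin_ext (@to_interval k (k%:Z - 2) Luv)
  (fun x => \sum_(1 <= j < k.+1) (-1) ^+ j *: mag_face R j x) f.
have simpE := linear_lin_ext (lin_ext (fun t : simplex Delta _ => bd_gen (val t)))
  (fun x : mag_simplex e k.+1 Luv => simp_gen R Delta (k.+1%:Z - 2)
     (interior (val x))) f.
rewrite [LHS]magE -[simp_bd _ _ _]/(lin_ext _ _) [in RHS]simpE.
rewrite (linear_lin_ext -%R).
apply: eq_lin_ext => x fx0 /=.
have [x0 xk] := from_to_ends f_uv fx0.
have [p [cp [pk] xE]] := simplex_fill x0 xk.
have up := interval_chain_uniq cp.
have [t tE] := interval_chain_simplex cp (congr1 S pk).
rewrite xE interior_fill // (lin_ext_delta _ (x := t)) => [|t']; last first.
  by rewrite ffunE -tE.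
rewrite tE /bd_gen.
(* The face [j = i + 1] deletes the entry of index [i] of [p], and the sum over
   the set of entries of [p] is reindexed by these [i]. *)
rewrite linear_sum big_add1 /= -sumrN.
rewrite [RHS](eq_bigl (mem p)) => [|a]; last by rewrite inE.
rewrite -(big_uniq _ up) /= (big_nth u) pk.
apply: eq_big_nat => i /andP[_ ik].
have ip : (i < size p)%N by rewrite pk.
rewrite linearZ_LR /= (mag_face_fill xE cp ip) card_below // -set_rem //.
rewrite exprS mulN1r scaleNr; congr (- (_ *: _)).
apply: to_interval_fill; first exact: interval_chain_rem.
by rewrite size_rem ?mem_nth // pk prednK // (leq_ltn_trans _ ik).
Qed.

Lemma magnitude_interval_iso :
  exists phi : forall k : nat,
      {linear MC_uv R e u v k Luv -> aug_chain R Delta (k%:Z - 2)},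
    (forall k, bijective (phi k)) /\
    exists s : nat -> bool, forall k (f : MC_uv R e u v k.+1 Luv),
      phi k (mag_bd_uv f) =
        (-1) ^+ s k *: simp_bd (dag_lt e) (k%:Z - 2) (phi k.+1 f).
Proof.
exists (fun k => (@to_interval k (k%:Z - 2) Luv \o val)%FUN); split=> [k|].
  exists (fun g => InMC_uv (of_interval_from_to g)) => [f|g].
    by apply: val_inj; rewrite /= to_intervalK ?(valP f).
  by rewrite /= of_intervalK.
by exists xpredT => k f; rewrite /= to_interval_bd ?(valP f) // expr1 scaleN1r.
Qed.

End Correspondence.

(** * Vanishing and the case of equal ends *)

Section Degenerate.
Variables (K : realType) (R : pzRingType) (V : finType) (e : rel V).
Hypothesis D_layered : layered_dag e K.

Lemma MC_uv_eq0 u v k L (f : @MC_uv K R V e u v k L) :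
    (forall x : mag_simplex e k L,
       entry (val x) 0 = u -> entry (val x) k = v -> False) ->
  f = 0.
Proof.
move=> no_x; apply/val_inj/ffunP => x; rewrite ffunE.
by apply/eqP/negPn/negP => /(from_to_ends (valP f))[]; apply: no_x.
Qed.

Lemma MC_uv_other_length u v k L : L%:E != dist e K u v ->
  forall f : @MC_uv K R V e u v k L, f = 0.
Proof.
move=> Luv f; apply: MC_uv_eq0 => x x0 xk.
by have [_ distE] := uv_simplex D_layered x0 xk; rewrite distE eqxx in Luv.
Qed.

(** A nonconstant increasing sequence cannot return to its starting point. *)
Lemma MC_uu_pos u k L (f : @MC_uv K R V e u u k.+1 L) : f = 0.
Proof.
have e_acyclic : acyclic e by case: D_layered => -[].
apply: MC_uv_eq0 => x; rewrite !(entry_nth u) // => x0 xk.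
have [lt_x _] : sorted (dag_lt e) (val x) /\ dist e K u u = L%:E.
  by apply: uv_simplex; rewrite ?(entry_nth u).
have : dag_lt e (nth u (val x) 0) (nth u (val x) k.+1).
  apply: (sorted_ltn_nth (dag_lt_trans e_acyclic) u lt_x) => //;
    by rewrite inE size_tuple.
by rewrite x0 xk dag_lt_irr.
Qed.

(** The only simplex of degree 0 from u to u is the tuple (u), so that the sum
    of the coefficients is an isomorphism. *)
Lemma MC_uu_0 u :
  exists phi : {linear @MC_uv K R V e u u 0 (fine (dist e K u u)) -> R^o},
    bijective phi.
Proof.
have [x xE] : exists x : mag_simplex e 0 (fine (dist e K u u) : K),
    val x = [:: u] :> seq V.
  suff xP : sorted [rel a b | a != b] [tuple u] &&
            (len K e [tuple u] == (fine (dist e K u u))%:E).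
    by exists (Sub [tuple u] xP); rewrite SubK.
  by rewrite /= /len big_geq // (dist_refl D_layered).
pose x_gen := mag_gen R e 0 (fine (dist e K u u) : K) (val x).
have gen_uu c : c *: x_gen \in from_to u u.
  apply: rpredZ; apply/forallP=> y; rewrite ffunE.
  case: (tval (val y) =P _) => [yE|_]; last by rewrite eqxx.
  by rewrite !(entry_nth u) // yE xE /= !eqxx implybT.
exists (lin_ext (fun=> 1 : R^o) \o val)%FUN.
exists (fun c => InMC_uv (gen_uu c)) => [f|c] /=; last first.
  rewrite linearZ_LR /= (lin_ext_delta _ (x := x)) => [|y]; last by rewrite ffunE.
  by rewrite [_ *: _]mulr1.
apply: val_inj; rewrite /= /lin_ext scaler_suml.
rewrite (eq_bigr (fun y => (val f y : R) *: x_gen)) => [|y _].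
  apply: lin_ext_id => y /(from_to_ends (valP f))[y0 _] z.
  rewrite ffunE; congr (_%:R); congr nat_of_bool.
  have yE : val y = [:: u] :> seq V.
    move: (size_tuple (val y)) y0; rewrite (entry_nth u) //.
    by case: (tval (val y)) => [//|a [|//]] _ /= ->.
  by rewrite xE -yE.
by congr (_ *: x_gen); apply: mulr1.
Qed.

End Degenerate.

Theorem theorem7 (K : realType) (R : pzRingType) (V : finType) (e : rel V)
    (D_layered : layered_dag e K) (u v : V) (uv : dag_le e u v) :
  let Luv : K := fine (dist e K u v) in
  let Delta := order_complex (dag_le e) (open_interval e u v) in
  [/\ u != v ->
      exists phi : forall k : nat,
          {linear MC_uv R e u v k Luv -> aug_chain R Delta (k%:Z - 2)},
        (forall k, bijective (phi k)) /\
        exists s : nat -> bool, forall k (f : MC_uv R e u v k.+1 Luv),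
          phi k (mag_bd_uv f) =
            (-1) ^+ s k *: simp_bd (dag_lt e) (k%:Z - 2) (phi k.+1 f),
      u = v ->
      (exists phi : {linear MC_uv R e u v 0 Luv -> R^o}, bijective phi) /\
      (forall k (f : MC_uv R e u v k.+1 Luv), f = 0)
    & forall (k : nat) (L : K), L%:E != dist e K u v ->
        forall f : MC_uv R e u v k L, f = 0].
Proof.
split=> [u_neq_v|<-|k L].
- exact: magnitude_interval_iso.
- split; [exact: MC_uu_0 | by move=> k f; apply: MC_uu_pos].
- exact: MC_uv_other_length.
Qed.
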